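(* Let $X$ be a topological space and let $Y$ be a second countable space. Then every $H_\sigma$-measurable map $f:X\to Y$ is $\sigma$-regular.
   Context: A set $A\subseteq X$ is an $H$-set (resolvable in the sense of Hausdorff) if for every closed set $F\subseteq X$ the set $\overline{F\cap A}\cap\overline{F\setminus A}$ is nowhere dense in $F$. A map $f:X\to Y$ is $H_\sigma$-measurable if the preimage of every open set $V\subseteq Y$ is a union of a sequence of $H$-subsets of $X$. A transfinite sequence $(U_\xi:\xi\in[0,\alpha])$ (with $\alpha$ an ordinal) of subsets of $X$ is regular in $X$ if: (a) each $U_\xi$ is open in $X$; (b) $\emptyset=U_0\subset U_1\subset U_2\subset\dots\subset U_\alpha=X$ (strictly increasing); (c) $U_\gamma=\bigcup_{\xi<\gamma}U_\xi$ for every limit ordinal $\gamma\le\alpha$. For $\xi\in[0,\alpha)$ put $P_{\xi+1}=U_{\xi+1}\setminus U_\xi$. The partition $(P_{\xi+1}:\xi\in[0,\alpha))$ of $X$ is called the regular partition associated with $(U_\xi)$; a regular partition of $X$ is a partition arising in this way. A family $\mathscr B$ of subsets of $X$ is a base for $f:X\to Y$ if for every open $V\subseteq Y$ there exists a subfamily $\mathscr B_V\subseteq\mathscr B$ with $f^{-1}(V)=\bigcup_{B\in\mathscr B_V}B$. A map $f:X\to Y$ is $\sigma$-regular if there exists a sequence $(\mathscr P_n)_{n\in\omega}$ of regular partitions of $X$ such that $\bigcup_{n\in\omega}\mathscr P_n$ is a base for $f$. *)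

(* Defs.v *)
From HB Require Import structures.
From mathcomp Require Import all_boot all_order.
From mathcomp Require Import all_classical.
From mathcomp Require Import topology.
From mathcomp Require wochoice.

Set Implicit Arguments.
Unset Strict Implicit.
Unset Printing Implicit Defensive.

Import Order.TTheory.

Local Open Scope classical_set_scope.
Local Open Scope order_scope.

(* Points outside F are isolated in [subspace F], hence the intersection. *)
Definition nowhere_dense_in (X : topologicalType) (F S : set X) : Prop :=
  interior (closure (S `&` F : set (subspace F))) = set0.

Definition Hset (X : topologicalType) (A : set X) : Prop :=
  forall F : set X, closed F ->
    nowhere_dense_in F (closure (F `&` A) `&` closure (F `\` A)).

Definition Hsigma_measurable (X Y : topologicalType) (f : X -> Y) : Prop :=
  forall V : set Y, open V ->
    exists A : nat -> set X,
      (forall n, Hset (A n)) /\ f @^-1` V = \bigcup_n A n.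

(* An ordinal interval [0, alpha] is represented, up to isomorphism, by a
   well-ordered type I with a least element \bot (that is, 0) and a greatest
   element \top (that is, alpha); the case \bot = \top is alpha = 0. *)

(* j = i + 1 *)
Definition is_succ_of d (I : porderType d) (i j : I) : Prop :=
  i < j /\ (forall k : I, ~ (i < k < j)).

Definition is_limit d (I : tbOrderType d) (g : I) : Prop :=
  g <> \bot /\ (forall i : I, ~ is_succ_of i g).

Record regular_sequence (X : topologicalType) d (I : tbOrderType d)
    (U : I -> set X) : Prop := RegularSequence {
  regseq_wo : wochoice.well_order (<=%O : rel I) ;
  regseq_open : forall i, open (U i) ;
  regseq_bot : U \bot = set0 ;
  regseq_top : U \top = setT ;
  regseq_incr : forall i j : I, i < j -> U i `<` U j ;
  regseq_lim : forall g : I, is_limit g ->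
    U g = \bigcup_(i in [set i | i < g]) U i
}.

Definition associated_partition (X : topologicalType) d (I : tbOrderType d)
    (U : I -> set X) : set (set X) :=
  [set P | exists i j : I, is_succ_of i j /\ P = U j `\` U i].

Definition regular_partition (X : topologicalType) (P : set (set X)) : Prop :=
  exists (d : Order.disp_t) (I : tbOrderType d) (U : I -> set X),
    regular_sequence U /\ P = associated_partition U.

Definition base_for (X Y : topologicalType) (f : X -> Y)
    (B : set (set X)) : Prop :=
  forall V : set Y, open V ->
    exists BV : set (set X), BV `<=` B /\ f @^-1` V = \bigcup_(A in BV) A.

Definition sigma_regular (X Y : topologicalType) (f : X -> Y) : Prop :=
  exists P : nat -> set (set X),
    (forall n, regular_partition (P n)) /\ base_for f (\bigcup_n P n).

(* Main.v *)
(* An H-set A is a union of members of one regular partition: if U is open and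
   F = X \ U is nonempty, then F is not contained in the intersection of the
   closures of F ∩ A and F \ A, so some open W meets F in a set that is either
   contained in A or disjoint from A; put U_{ξ+1} = U_ξ ∪ W and iterate
   transfinitely. Applying this to countably many H-sets whose unions give the
   preimages of a countable base of Y yields the required sequence.

   Ordinals are avoided by indexing the iteration by its own values: the least
   family of subsets closed under the successor step and under unions is well
   ordered by inclusion (Bourbaki-Witt). *)
From HB Require Import structures.
Require Import Defs.
From mathcomp Require Import all_boot all_order.
From mathcomp Require Import all_classical.
From mathcomp Require Import topology.

Set Implicit Arguments.
Unset Strict Implicit.
Unset Printing Implicit Defensive.

Import Order.TTheory.

Local Open Scope classical_set_scope.
Local Open Scope order_scope.

(** * Well-ordered towers of subsets generated by a successor step *)

Section Tower.
Variables (T : Type) (w : set T -> set T).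

(** The empty set belongs to the tower as the union of the empty family, so no base case is
    listed. *)
Inductive tower : set T -> Prop :=
| tower_step U : tower U -> tower (U `|` w U)
| tower_bigcup (S : set (set T)) :
    S `<=` tower -> tower (\bigcup_(U in S) U).

(** Double induction: the outer one on [U], for all [V] at once; in its successor case, an inner one
    on [V] shows that no member lies strictly between [U] and its successor. *)
Lemma tower_comparable U V : tower U -> tower V ->
  U `<=` V \/ V `|` w V `<=` U.
Proof.
move=> tU; elim: tU V => {U} [U tU IH|S _ IH] V tV; last first.
  have [SV|/existsNP[U /not_implyP[SU nUV]]] :=
      pselect (forall U, S U -> U `<=` V).
    by left=> x [U SU Ux]; exact: SV Ux.
  right; case: (IH _ SU V tV) => // VU.
  exact: subset_trans VU (bigcup_sup SU).
have : V `<=` U \/ U `|` w U `<=` V.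
  elim: tV => {V} [V tV IHV|S tS IHS].
    have [UV|] := IH V tV; last by left.
    have [VU|UV'] := IHV; last by right=> x /UV' Vx; left.
    by have -> : U = V; [exact/seteqP | right].
  have [SU|/existsNP[V /not_implyP[SV nVU]]] :=
      pselect (forall V, S V -> V `<=` U).
    by left=> x [V SV Vx]; exact: SU Vx.
  by right; case: (IHS _ SV) => // UV; exact: subset_trans UV (bigcup_sup SV).
case=> [VU|]; last by left.
have [UV|UV] := IH V tV; last by right=> x /UV; left.
by have -> : V = U; [exact/seteqP | right].
Qed.

Definition tower_type := {U : set T | `[< tower U >]}.

HB.instance Definition _ := SubChoice.on tower_type.
HB.instance Definition _ :=
  [SubChoice_isSubPOrder of tower_type by <: with set_display].

Definition TowerType U (tU : tower U) : tower_type := exist _ U (asboolT tU).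

Lemma towerP (i : tower_type) : tower (val i).
Proof. by case: i => U tU; apply/asboolP. Qed.

Lemma tower_leP (i j : tower_type) : reflect (val i `<=` val j) (i <= j).
Proof. by rewrite leEsub; apply: (iffP idP); rewrite subsetEset. Qed.

Lemma tower_le_total : total (<=%O : rel tower_type).
Proof.
move=> i j; have [ij|ji] := tower_comparable (towerP i) (towerP j).
  by apply/orP; left; apply/tower_leP.
by apply/orP; right; apply/tower_leP => x jx; apply: ji; left.
Qed.

HB.instance Definition _ :=
  Order.POrder_isTotal.Build _ tower_type tower_le_total.

Fact tower_bigcup_val (S : set tower_type) : tower (\bigcup_(i in S) val i).
Proof.
by rewrite -(bigcup_image S val id); apply: tower_bigcup => U [i _ <-]; exact: towerP.
Qed.

Definition tower_union (S : set tower_type) : tower_type :=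
  TowerType (tower_bigcup_val S).

Lemma tower_unionE (S : set tower_type) :
  val (tower_union S) = \bigcup_(i in S) val i.
Proof. by []. Qed.

Lemma tower_union_ub (S : set tower_type) i : S i -> i <= tower_union S.
Proof. by move=> Si; apply/tower_leP; exact: bigcup_sup. Qed.

Lemma tower_union_lub (S : set tower_type) j :
  (forall i, S i -> i <= j) -> tower_union S <= j.
Proof.
move=> Sj; apply/tower_leP; rewrite tower_unionE => x [i /Sj/tower_leP]; exact.
Qed.

Fact tower_bot_le (i : tower_type) : tower_union set0 <= i.
Proof. exact: tower_union_lub. Qed.

Fact tower_le_top (i : tower_type) : i <= tower_union setT.
Proof. exact: tower_union_ub. Qed.

HB.instance Definition _ :=
  Order.hasBottom.Build _ tower_type tower_bot_le.
HB.instance Definition _ := Order.hasTop.Build _ tower_type tower_le_top.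

Definition tower_succ (i : tower_type) : tower_type :=
  TowerType (tower_step (towerP i)).

Lemma lt_tower_succ_le i j : i < j -> tower_succ i <= j.
Proof.
rewrite ltNge => /negP nji.
by have [/tower_leP//|ij] := tower_comparable (towerP j) (towerP i); apply/tower_leP.
Qed.

(** Otherwise the union of all members below [g] is itself below [g] and bounds them all, so [g] is
    its immediate successor. *)
Lemma tower_limitE (g : tower_type) : is_limit g ->
  val g = \bigcup_(i in [set i | i < g]) val i.
Proof.
move=> [_ ng]; rewrite -tower_unionE; congr val.
apply/le_anti/andP; split; last by apply: tower_union_lub => i /ltW.
rewrite leNgt; apply/negP => lt_g; apply: (ng _); split; first exact: lt_g.
move=> k /andP[mk kg]; have := tower_union_ub (kg : [set i | i < g] k).
by rewrite leNgt mk.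
Qed.

Hypothesis w_progress : forall U, tower U -> U <> setT -> w U `\` U !=set0.

Lemma tower_topE : val (\top : tower_type) = setT.
Proof.
apply: contrapT => /(w_progress (towerP _)) [x [wx]]; apply.
by have /tower_leP := lex1 (tower_succ \top); apply; right.
Qed.

Lemma lt_tower_succ i : val i <> setT -> i < tower_succ i.
Proof.
move=> /(w_progress (towerP i)) [x [wx nx]]; rewrite ltNge.
by apply/negP => /tower_leP si; apply: nx; apply: si; right.
Qed.

Lemma is_succ_of_tower_succ i : val i <> setT -> is_succ_of i (tower_succ i).
Proof.
move=> iT; split; first exact: lt_tower_succ.
by move=> k /andP[/lt_tower_succ_le]; rewrite leNgt => /negP.
Qed.

Lemma is_succ_ofE (i j : tower_type) : is_succ_of i j -> j = tower_succ i.
Proof.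
move=> [ij nk]; have := lt_tower_succ_le ij; rewrite le_eqVlt => /orP[/eqP//|sj].
(* A strict [tower_succ i < j] would put [tower_succ i] between [i] and [j]; the step is strict
   because [i < j] keeps [val i] from being the whole space. *)
exfalso; apply: (nk (tower_succ i)); rewrite sj andbT; apply: lt_tower_succ => iT.
have /lt_eqF/eqP := ij; apply; apply/le_anti; rewrite (ltW ij).
by apply/tower_leP; rewrite iT.
Qed.

(** The minimum of [A] is the union [m] of its lower bounds: if [m] were outside [A], its successor
    would be a strictly larger lower bound. *)
Lemma tower_well_order : wochoice.well_order (<=%O : rel tower_type).
Proof.
apply: wochoice.antisymmetric_well_order; first exact: le_anti.
move=> A [a Aa]; pose m := tower_union [set t | forall s, s \in A -> t <= s].
have mlb s : s \in A -> m <= s by move=> As; apply: tower_union_lub => t; exact.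
exists m; split; last by move=> s /mlb.
apply: contrapT => nAm.
have lt_m s : s \in A -> m < s.
  move=> As; rewrite lt_neqAle mlb// andbT; apply/eqP => ms.
  by apply: nAm; rewrite ms.
have mT : val m <> setT.
  move=> mT; have := lt_m _ Aa; rewrite ltNge => /negP; apply.
  by apply/tower_leP; rewrite mT.
have := lt_tower_succ mT; rewrite ltNge => /negP; apply.
by apply: tower_union_ub => s /lt_m/lt_tower_succ_le.
Qed.

Lemma tower_succ_cover x : exists i, (val (tower_succ i) `\` val i) x.
Proof.
(* This is the largest member missing [x], so its successor must contain [x]. *)
pose m := tower_union [set t | ~ val t x].
have nmx : ~ val m x by rewrite tower_unionE => -[].
exists m; split=> //; apply: contrapT => nsx.
have mT : val m <> setT by move=> mT; apply: nmx; rewrite mT.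
have := lt_tower_succ mT; rewrite ltNge => /negP; apply.
exact: tower_union_ub.
Qed.

End Tower.

(** * Regular partitions from towers of open sets, and their use for H-sets *)

Lemma tower_open (X : topologicalType) (w : set X -> set X) (U : set X) :
  (forall U, open (w U)) -> tower w U -> open U.
Proof.
by move=> wo; elim=> {U} [U _ oU|S _ oS]; [exact: openU | exact: bigcup_open].
Qed.

Lemma regular_sequence_tower (X : topologicalType) (w : set X -> set X) :
  (forall U, open (w U)) ->
  (forall U, open U -> U <> setT -> w U `\` U !=set0) ->
  regular_sequence (val : tower_type w -> set X) /\
  associated_partition (val : tower_type w -> set X) =
    [set P | exists2 i : tower_type w, val i <> setT &
      P = val (tower_succ i) `\` val i].
Proof.
move=> wo wp.
have wp' U : tower w U -> U <> setT -> w U `\` U !=set0 by move=> /(tower_open wo)/wp.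
split.
  split.
  - exact: tower_well_order.
  - by move=> i; exact/tower_open/towerP.
  - by rewrite tower_unionE bigcup_set0.
  - exact: tower_topE.
  - move=> i j; rewrite lt_leAnge => /andP[/tower_leP ij /negP nji].
    by split=> // ji; apply: nji; apply/tower_leP.
  - exact: tower_limitE.
apply/seteqP; split=> [P [i [j [ij ->]]]|P [i iT ->]].
  rewrite (is_succ_ofE wp' ij); exists i => // iT.
  have [+ _] := ij; rewrite ltNge => /negP; apply.
  by apply/tower_leP; rewrite iT.
by exists i, (tower_succ i); split=> //; exact: is_succ_of_tower_succ.
Qed.

Lemma Hset_open_split (X : topologicalType) (A F : set X) :
  Hset A -> closed F -> F !=set0 ->
  exists W, [/\ open W, W `&` F !=set0 &
    W `&` F `<=` A \/ W `&` F `<=` ~` A].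
Proof.
move=> HA Fcl [x Fx].
set S := closure (F `&` A) `&` closure (F `\` A).
have [y [Fy nSy]] : F `\` S !=set0.
  apply: contrapT => /nonemptyPn; rewrite setD_eq0 => FS; have := HA F Fcl.
  rewrite /nowhere_dense_in -/S (setIidr FS) => int0.
  suff : interior (closure (F : set (subspace F))) x by rewrite int0.
  (* [F] is open in its own subspace topology, so a nonempty [F] is not nowhere dense in itself. *)
  by apply: (interiorS (@subset_closure _ _)); apply: open_subspaceT.
have [ny|ny] : ~ closure (F `&` A) y \/ ~ closure (F `\` A) y.
  exact/not_andP.
- exists (~` closure (F `&` A)); split.
  + exact/closed_openC/closed_closure.
  + by exists y.
  + by right=> z [nz Fz] Az; apply: nz; exact: subset_closure.
- exists (~` closure (F `\` A)); split.
  + exact/closed_openC/closed_closure.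
  + by exists y.
  + by left=> z [nz Fz]; apply: contrapT => nAz; apply: nz; exact: subset_closure.
Qed.

Lemma Hset_regular_partition (X : topologicalType) (A : set X) : Hset A ->
  exists P, regular_partition P /\
    forall x, A x -> exists B, [/\ P B, B x & B `<=` A].
Proof.
move=> HA.
have /choice[w wP] (U : set X) : exists W, [/\ open W,
    W `\` U `<=` A \/ W `\` U `<=` ~` A &
    open U -> U <> setT -> W `\` U !=set0].
  have [[oU UT]|nU] := pselect (open U /\ U <> setT).
    have : ~` U !=set0.
      by apply: contrapT => /nonemptyPn; rewrite -setCT => /setC_inj.
    by move=> /(Hset_open_split HA (open_closedC oU)) [W [oW W0 WA]]; exists W.
  (* Default value where no progress is required: [U] is not open or is already the whole space. *)
  exists set0; split; first exact: open0.
  - by left=> x [].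
  - by move=> oU UT; case: nU.
have wo U : open (w U) by case: (wP U).
have wp U : open U -> U <> setT -> w U `\` U !=set0 by case: (wP U).
have [Useq PE] := regular_sequence_tower wo wp.
exists (associated_partition (val : tower_type w -> set X)); split.
  by exists set_display, (tower_type w), val.
move=> x Ax; have wp' U : tower w U -> U <> setT -> w U `\` U !=set0.
  by move=> /(tower_open wo)/wp.
have [i ix] := tower_succ_cover wp' x.
exists (val (tower_succ i) `\` val i); split=> //.
  by rewrite PE; exists i => // iT; case: ix => _; apply; rewrite iT.
(* The piece through [x] is thus inside [A] or disjoint from [A], and [x] rules out the latter. *)
have -> : val (tower_succ i) `\` val i = w (val i) `\` val i.
  by rewrite [LHS]setDUl setDv set0U.
have [_ [//|wnA] _] := wP (val i).
by case: ix => -[//|wx] nx; have := wnA x (conj wx nx).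
Qed.

Lemma second_countable_sequence (Y : topologicalType) :
  @second_countable Y -> exists s : nat -> set Y, (forall n, open (s n)) /\
    forall V y, open V -> V y -> exists n, s n y /\ s n `<=` V.
Proof.
move=> [B /countable_injP[e einj] [Bo Bnbhs]].
have /choice[s sP] n : exists W, open W /\ forall V, B V -> e V = n -> W = V.
  have [[V [BV Vn]]|nV] := pselect (exists V, B V /\ e V = n).
    exists V; split; first exact: Bo.
    by move=> V' BV' V'n; apply: einj; rewrite ?inE// Vn.
  (* Indices outside the range of [e] get the empty set, which keeps every term of the sequence
     open. *)
  exists set0; split; first exact: open0.
  by move=> V BV Vn; case: nV; exists V.
exists s; split=> [n|V y oV Vy]; first by case: (sP n).
have [W [BW Wy] WV] := Bnbhs y V (open_nbhs_nbhs (conj oV Vy)).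
by exists (e W); rewrite ((sP (e W)).2 W BW erefl).
Qed.

Theorem proposition4p12 (X Y : topologicalType) (f : X -> Y) :
  @second_countable Y -> Hsigma_measurable f -> sigma_regular f.
Proof.
move=> /second_countable_sequence[s [so sV]] fH.
have /choice[A AP] n := fH _ (so n).
have /choice[P PP] (nm : nat * nat) := Hset_regular_partition ((AP nm.1).1 nm.2).
(* Pairs (basic open set, H-set in its preimage) are coded by one index; a [k] coding no pair merely
   repeats the partition of [(0, 0)]. *)
exists (fun k => P (odflt (0, 0) (unpickle k))); split=> [k|V oV].
  by case: (PP (odflt (0, 0) (unpickle k))).
(* Taking all pieces inside the preimage leaves only its covering to prove. *)
exists [set B | (\bigcup_k P (odflt (0, 0) (unpickle k))) B /\ B `<=` f @^-1` V].
split=> [B []//|]; apply/seteqP; split=> [x fVx|x [B [_ BV] /BV//]].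
have [n [snx snV]] := sV V (f x) oV fVx.
have [_ fE] := AP n; have [m _ Ax] : (\bigcup_m A n m) x by rewrite -fE.
have [_ /(_ x Ax)[B [PB Bx BA]]] := PP (n, m).
exists B => //; split; first by exists (pickle (n, m)); rewrite // pickleK.
by move=> z /BA Az; apply: snV; rewrite -[s n (f z)]/((f @^-1` s n) z) fE; exists m.
Qed.
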